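(* For $n\in\mathbb Z$, the A-polynomial $A_{2n}=A_{2n}(L,M)$ of the twist knot $T_{2n}$ is given explicitly by $$A_{2n}=\begin{cases}\displaystyle -M^{2n}(1+LM^2)^{2n}\sum_{i=0}^{2n}\binom{n+\lfloor i/2\rfloor}{i}(1-M^2)^i(1+LM^2)^{-i}(L-1)^{\lfloor i/2\rfloor}(LM^2-M^{-2})^{\lfloor (1+i)/2\rfloor}, & n\ge 0,\\[3mm] \displaystyle M^{-2n}(1+LM^2)^{-2n-1}\sum_{i=0}^{-2n-1}\binom{-n+\lfloor (i-1)/2\rfloor}{i}(M^2-1)^i(1+LM^2)^{-i}(L-1)^{\lfloor i/2\rfloor}(LM^2-M^{-2})^{\lfloor (1+i)/2\rfloor}, & n<0.\end{cases}$$
   Context: $T_m$ is the twist knot having a regular planar projection with 2 left-handed vertical crossings (the clasp) and $m$ right-handed horizontal crossings (the twist region; negative $m$ means crossings of the opposite handedness); $T_{2n}$ is the two-bridge knot of slope $2/(4n+1)$. Its exterior $X_{2n}$ has $\pi_1(X_{2n})=\langle s,t\mid swt^{-1}w^{-1}=1\rangle$, $w=(ts^{-1}t^{-1}s)^n$, with $s,t$ meridians. The canonical (null-homologous) longitude commuting with $s$ is $\ell=ww^*$, where $w^*=(st^{-1}s^{-1}t)^n$ is the word $w$ read backwards. The A-polynomial is computed using the representations $\eta':\pi_1(X_{2n})\to SL(2,\mathbb C)$ of the form $\eta'(s)=\begin{pmatrix}M&1\\0&M^{-1}\end{pmatrix}$, $\eta'(t)=\begin{pmatrix}M&0\\ y&M^{-1}\end{pmatrix}$.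 For a nonabelian such representation, $L$ denotes the upper-left entry (eigenvalue) of the upper triangular matrix $\eta'(\ell)$. The A-polynomial $A_{2n}(L,M)\in\mathbb Z[L,M]$ is the polynomial (with coprime integer coefficients and no repeated factors, well defined up to sign) defining the Zariski closure of the set of pairs $(L,M)$ arising from nonabelian representations; the factor $L-1$ coming from abelian representations is not included, and $A_0$ is a unit. The formula in the claim fixes the sign. $\lfloor\cdot\rfloor$ is the floor function. *)

(* Defs.v *)
From mathcomp Require Import all_boot all_order all_algebra.
From mathcomp Require Export reals complex.

Set Implicit Arguments.
Unset Strict Implicit.
Unset Printing Implicit Defensive.

Import GRing.Theory.
Local Open Scope ring_scope.

(* The knot T_{2n} enters through the group of its exterior,
     pi_1(X_{2n}) = < s, t | s w t^-1 w^-1 = 1 >,  w = (t s^-1 t^-1 s)^n,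
   together with its longitude l = w w*, where w* is w read backwards.  A
   representation of this group is a pair of matrices (images of s and t)
   satisfying the relator.  For n < 0 the power [^] is that of the inverse. *)
Definition twist_word (G : unitRingType) (n : int) (s t : G) : G :=
  (t * s^-1 * t^-1 * s) ^ n.

Definition twist_word_rev (G : unitRingType) (n : int) (s t : G) : G :=
  (s * t^-1 * s^-1 * t) ^ n.

Definition longitude (G : unitRingType) (n : int) (s t : G) : G :=
  twist_word n s t * twist_word_rev n s t.

Definition is_SL2_rep (K : fieldType) (n : int) (s t : 'M[K]_2) : Prop :=
  [/\ \det s = 1, \det t = 1
    & s * twist_word n s t * t^-1 * (twist_word n s t)^-1 = 1].

Definition nonabelian_rep (K : fieldType) (s t : 'M[K]_2) : Prop :=
  s * t <> t * s.

Definition mx2 (K : fieldType) (a b c d : K) : 'M[K]_2 :=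
  \matrix_(i, j) (if i == 0 then (if j == 0 then a else b)
                            else (if j == 0 then c else d)).

Definition eta_s (K : fieldType) (M : K) : 'M[K]_2 := mx2 M 1 0 M^-1.
Definition eta_t (K : fieldType) (M y : K) : 'M[K]_2 := mx2 M 0 y M^-1.

(* [M != 0] is needed since [0^-1 = 0]. *)
Definition eigenvalue_pair (K : fieldType) (n : int) (L M : K) : Prop :=
  M != 0 /\
  exists y : K,
    [/\ is_SL2_rep n (eta_s M) (eta_t M y),
        nonabelian_rep (eta_s M) (eta_t M y)
      & L = longitude n (eta_s M) (eta_t M y) 0 0].

(* An element p of {poly {poly K}} is a polynomial in (L, M): L is the outer
   variable 'X, M is the inner variable 'Y = 'X%:P, and p.[a, b] is the value
   at L = a, M = b. *)
Definition zariski_closure (K : fieldType) (S : K -> K -> Prop) (a b : K) :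
    Prop :=
  forall p : {poly {poly K}},
    (forall x y : K, S x y -> p.[x, y] = 0) -> p.[a, b] = 0.

Definition polyZ_to (K : fieldType) (A : {poly {poly int}}) :
    {poly {poly K}} :=
  map_poly (map_poly (intr : int -> K)) A.

Definition coprime_coefs (A : {poly {poly int}}) : Prop :=
  forall d : int, (forall i j : nat, (d %| A`_i`_j)%Z) -> `|d| = 1.

Definition no_repeated_factor (A : {poly {poly int}}) : Prop :=
  forall q r : {poly {poly int}}, A = q ^+ 2 * r -> q \is a GRing.unit.

(* These conditions determine A up to sign. *)
Definition is_A_polynomial (K : fieldType) (n : int) (A : {poly {poly int}}) :
    Prop :=
  [/\ coprime_coefs A, no_repeated_factor A
    & forall L M : K,
        (polyZ_to K A).[L, M] = 0 <->
        zariski_closure (eigenvalue_pair n) L M].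

(* The variables L and M in the field of fractions of Z[L, M], where the
   negative powers in the closed formula make sense. *)
Definition fracL : {fraction {poly {poly int}}} := tofrac 'X.
Definition fracM : {fraction {poly {poly int}}} := tofrac 'Y.

(* [%/] on int with a positive divisor is the floor, so that
   [((0 - 1) %/ 2)%Z = -1]; the upper binomial indices below are always
   nonnegative, and [absz] only casts them to nat. *)
Definition twist_formula (n : int) : {fraction {poly {poly int}}} :=
  let L := fracL in let M := fracM in
  if 0 <= n then
    - M ^ (2 * n) * (1 + L * M ^ 2) ^ (2 * n) *
    \sum_(0 <= i < (2 * absz n).+1)
      'C(absz n + i./2, i)%:R * (1 - M ^ 2) ^+ i * (1 + L * M ^ 2) ^- i *
      (L - 1) ^+ (i./2) * (L * M ^ 2 - M ^ (- 2)) ^+ ((1 + i)./2)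
  else
    M ^ (- 2 * n) * (1 + L * M ^ 2) ^ (- 2 * n - 1) *
    \sum_(0 <= i < (absz (- 2 * n - 1)%R).+1)
      'C(absz (- n + ((i%:Z - 1) %/ 2)%Z), i)%:R * (M ^ 2 - 1) ^+ i *
      (1 + L * M ^ 2) ^- i *
      (L - 1) ^+ (i./2) * (L * M ^ 2 - M ^ (- 2)) ^+ ((1 + i)./2).

(* Main.v *)
Require Import Defs.
From mathcomp Require Import all_boot all_order all_algebra all_field.
From mathcomp Require Import reals complex.
From mathcomp Require Import zify ring.

(* Write w = W^n with W = t s^-1 t^-1 s.  Cayley-Hamilton expresses w through
   Chebyshev polynomials of tr W = 2 + y (y + c - 2), where c = M^2 + M^-2, and
   s w - w t turns out to be riley n c y times s - t: representations are the
   zeros of Riley's polynomial, which is monic in y.  On these zeros L and y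
   determine each other through y (1 + L M^2) = (M^2 - 1) (L - 1), and the closed
   formula is riley n c y after clearing denominators in this substitution,
   because sum_i bin_i a^(i/2) b^((i+1)/2) = riley n c y for a = - y and
   b = 2 - c - y.
   At c = -2 (dihedral representations) riley is a Chebyshev polynomial without
   double roots, so by a resultant it has riley_deg n distinct roots y, hence
   riley_deg n distinct values of L, for all but finitely many M.  As the leading
   coefficient in L is +-M^e and the formula does not vanish identically at
   M = 0, this yields both squarefreeness and, by division with remainder in L,
   that the formula divides every polynomial vanishing on the eigenvalue pairs. *)

Set Implicit Arguments.
Unset Strict Implicit.
Unset Printing Implicit Defensive.
Import Order.TTheory GRing.Theory Num.Theory.
Local Open Scope ring_scope.

(** * Chebyshev polynomials with integer index *)

Section Chebyshev.
Variable R : comNzRingType.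
Implicit Type x : R.

Fixpoint chebn x (n : nat) : R :=
  if n is n1.+1 then if n1 is n2.+1 then x * chebn x n1 - chebn x n2 else 1
  else 0.

(* The Chebyshev polynomials of the second kind, shifted so that
   [cheb x n = (z ^ n - z ^ - n) / (z - z^-1)] for [x = z + z^-1]. *)
Definition cheb x (n : int) : R :=
  match n with Posz k => chebn x k | Negz k => - chebn x k.+1 end.

Lemma chebnSS x n : chebn x n.+2 = x * chebn x n.+1 - chebn x n.
Proof. by []. Qed.

Lemma chebN x n : cheb x (- n) = - cheb x n.
Proof. by case: n => [[|n]|n]; rewrite ?oppr0 //= ?opprK // oppr0. Qed.

Lemma chebD1 x n : cheb x (n + 1) = x * cheb x n - cheb x (n - 1).
Proof.
case: n => [[|n]|[|n]].
- by rewrite /=; ring.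
- have -> : n.+1%:Z + 1 = n.+2 by lia.
  by have -> : n.+1%:Z - 1 = n by lia.
- by rewrite /= !subr0; ring.
have -> : Negz n.+1 + 1 = Negz n by lia.
have -> : Negz n.+1 - 1 = Negz n.+2 by lia.
rewrite /cheb (chebnSS _ n.+1); ring.
Qed.

Lemma chebB1 x n : cheb x (n - 1) = x * cheb x n - cheb x (n + 1).
Proof. by rewrite chebD1; ring. Qed.

End Chebyshev.

Lemma rmorph_cheb (R S : comNzRingType) (f : {rmorphism R -> S}) x n :
  f (cheb x n) = cheb (f x) n.
Proof.
have H k : f (chebn x k) = chebn (f x) k.
  elim/ltn_ind: k => -[|[|k]] IH; rewrite ?rmorph0 ?rmorph1 //.
  by rewrite !chebnSS rmorphB rmorphM !IH.
by case: n => k; rewrite /cheb ?rmorphN H.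
Qed.

(* Riley's polynomial of the twist knot, in c = M^2 + M^-2 and y. *)
Definition riley (R : comNzRingType) (n : int) (c y : R) : R :=
  let x := 2 + y * (y + c - 2) in cheb x (n + 1) + (1 - c - y) * cheb x n.

Lemma rmorph_riley (R S : comNzRingType) (f : {rmorphism R -> S}) n c y :
  f (riley n c y) = riley n (f c) (f y).
Proof.
by rewrite /riley !(rmorphD, rmorphM, rmorph_cheb, rmorphB, rmorphN, rmorph1, rmorph_nat).
Qed.

(** * Powers of two-by-two matrices of determinant 1 *)

Section Matrices.
Variable K : fieldType.
Implicit Types (a b c d M y : K).

Lemma mx2P (A B : 'M[K]_2) :
  A 0 0 = B 0 0 -> A 0 1 = B 0 1 -> A 1 0 = B 1 0 -> A 1 1 = B 1 1 -> A = B.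
Proof.
have ord2 (i : 'I_2) : i = 0 \/ i = 1.
  by case: i => [[|[|//]] ?]; [left | right]; apply: val_inj.
move=> h00 h01 h10 h11; apply/matrixP => i j.
by case: (ord2 i) => ->; case: (ord2 j) => ->.
Qed.

Lemma mulmx2 a b c d a' b' c' d' :
  mx2 a b c d * mx2 a' b' c' d' =
  mx2 (a * a' + b * c') (a * b' + b * d') (c * a' + d * c') (c * b' + d * d').
Proof. by apply: mx2P; rewrite !mxE !big_ord_recl big_ord0 !mxE /= addr0. Qed.

Lemma mx2_id : mx2 1 0 0 1 = 1 :> 'M[K]_2.
Proof. by apply: mx2P; rewrite !mxE. Qed.

Lemma det_mx2 a b c d : \det (mx2 a b c d) = a * d - b * c.
Proof.
rewrite (expand_det_row _ 0) !big_ord_recl big_ord0 /cofactor !det_mx11 !mxE /=.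
by rewrite expr0 expr1; ring.
Qed.

Lemma mulmx2V a b c d : a * d - b * c = 1 ->
  mx2 a b c d * mx2 d (- b) (- c) a = 1.
Proof. by move=> h; rewrite mulmx2 -mx2_id; congr mx2; rewrite -?h; ring. Qed.

Lemma mulVmx2 a b c d : a * d - b * c = 1 ->
  mx2 d (- b) (- c) a * mx2 a b c d = 1.
Proof. by move=> h; rewrite mulmx2 -mx2_id; congr mx2; rewrite -?h; ring. Qed.

Lemma mx2_unit a b c d : a * d - b * c = 1 ->
  mx2 a b c d \is a GRing.unit.
Proof.
by move=> h; apply/unitrP; exists (mx2 d (- b) (- c) a); rewrite mulmx2V ?mulVmx2.
Qed.

Lemma invmx2 a b c d : a * d - b * c = 1 ->
  (mx2 a b c d)^-1 = mx2 d (- b) (- c) a.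
Proof.
by move=> h; apply: (mulrI (mx2_unit h)); rewrite divrr ?mx2_unit // mulmx2V.
Qed.

(* Cayley-Hamilton makes the powers of a matrix of determinant 1 linear
   combinations of that matrix and the identity. *)
Lemma exprz_mx2 a b c d (n : int) : a * d - b * c = 1 ->
  let u := cheb (a + d) n in let v := cheb (a + d) (n - 1) in
  mx2 a b c d ^ n = mx2 (u * a - v) (u * b) (u * c) (u * d - v).
Proof.
move=> h /=; have U := mx2_unit h.
have h1 : a * d = 1 + b * c by rewrite -h; ring.
elim/int_rect: n => [|n IH|n IH].
- by rewrite expr0z -mx2_id /=; congr mx2; ring.
- have -> : n.+1%:Z = n%:Z + 1 by lia.
  rewrite exprzDr // expr1z IH mulmx2 addrK chebD1.
  move: (cheb _ _) (cheb _ _) => u v.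
  congr mx2; ring: h1.
have -> : - n.+1%:Z = - n%:Z - 1 by lia.
rewrite exprzDr // exprN1 invmx2 // IH mulmx2.
rewrite [cheb _ (_ - 1 - 1)]chebB1 subrK.
move: (cheb _ _) (cheb _ _) => u v.
congr mx2; ring: h1.
Qed.

End Matrices.

(** This is the determinant of [u W - v] for a matrix [W] of trace [x] and determinant 1, that is,
    of [W ^ n]. *)
Lemma cheb_cassini (R : comNzRingType) (x : R) (n : int) :
  cheb x n ^+ 2 - x * cheb x n * cheb x (n - 1) + cheb x (n - 1) ^+ 2 = 1.
Proof.
elim/int_rect: n => [|n IH|n IH]; first by rewrite /=; ring.
- have -> : n.+1%:Z = n%:Z + 1 by lia.
  by rewrite addrK chebD1 -[RHS]IH; ring.
have -> : - n.+1%:Z = - n%:Z - 1 by lia.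
by rewrite [cheb _ (_ - 1 - 1)]chebB1 subrK -[RHS]IH; ring.
Qed.

Lemma cheb_at2 (R : comNzRingType) (n : int) : cheb (2 : R) n = n%:~R.
Proof.
suff: cheb (2 : R) n = n%:~R /\ cheb (2 : R) (n - 1) = (n - 1)%:~R by case.
elim/int_rect: n => [|n [IH1 IH2]|n [IH1 IH2]]; first by rewrite sub0r chebN rmorphN.
- have -> : n.+1%:Z = n%:Z + 1 by lia.
  by rewrite addrK chebD1 IH1 IH2; split=> //; rewrite !intrD; ring.
have -> : - n.+1%:Z = - n%:Z - 1 by lia.
rewrite [cheb _ (_ - 1 - 1)]chebB1 subrK IH1 IH2; split=> //.
by rewrite !intrD; ring.
Qed.

(** * Representations as zeros of Riley's polynomial *)

Section Representations.
Variables (K : fieldType) (M : K).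
Hypothesis M0 : M != 0.
Implicit Type y : K.
Let s := eta_s M.
Let t y := eta_t M y.
Let c := M ^+ 2 + M^-1 ^+ 2.

Lemma eta_sV : s^-1 = mx2 M^-1 (- 1) 0 M.
Proof. by rewrite /s /eta_s invmx2 ?oppr0 // mulr0 subr0 divff. Qed.

Lemma eta_tV y : (t y)^-1 = mx2 M^-1 0 (- y) M.
Proof. by rewrite /t /eta_t invmx2 ?oppr0 // mul0r subr0 divff. Qed.

Lemma eta_commutator y : t y * s^-1 * (t y)^-1 * s =
  mx2 (1 + y * M ^+ 2) (M^-1 - M * (1 - y))
      (y * M^-1 - (1 - y) * y * M) (y * M^-1 ^+ 2 + (1 - y) ^+ 2).
Proof.
rewrite eta_sV eta_tV /s /t /eta_s /eta_t !mulmx2.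
by congr mx2; field.
Qed.

Lemma eta_commutator_rev y : s * (t y)^-1 * s^-1 * t y =
  mx2 ((1 - y) ^+ 2 + y * M ^+ 2) (M - M^-1 * (1 - y))
      (y * M - (1 - y) * y * M^-1) (y * M^-1 ^+ 2 + 1).
Proof.
rewrite eta_sV eta_tV /s /t /eta_s /eta_t !mulmx2.
by congr mx2; field.
Qed.

Lemma twist_word_eta n y :
  let u := cheb (2 + y * (y + c - 2)) n in
  let v := cheb (2 + y * (y + c - 2)) (n - 1) in
  twist_word n s (t y) =
  mx2 (u * (1 + y * M ^+ 2) - v) (u * (M^-1 - M * (1 - y)))
      (u * (y * M^-1 - (1 - y) * y * M))
      (u * (y * M^-1 ^+ 2 + (1 - y) ^+ 2) - v).
Proof.
rewrite /twist_word eta_commutator exprz_mx2; last by field.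
have -> // : 1 + y * M ^+ 2 + (y * M^-1 ^+ 2 + (1 - y) ^+ 2)
          = 2 + y * (y + c - 2) by rewrite /c; field.
Qed.

Lemma twist_word_rev_eta n y :
  let u := cheb (2 + y * (y + c - 2)) n in
  let v := cheb (2 + y * (y + c - 2)) (n - 1) in
  twist_word_rev n s (t y) =
  mx2 (u * ((1 - y) ^+ 2 + y * M ^+ 2) - v) (u * (M - M^-1 * (1 - y)))
      (u * (y * M - (1 - y) * y * M^-1))
      (u * (y * M^-1 ^+ 2 + 1) - v).
Proof.
rewrite /twist_word_rev eta_commutator_rev exprz_mx2; last by field.
have -> // : (1 - y) ^+ 2 + y * M ^+ 2 + (y * M^-1 ^+ 2 + 1)
          = 2 + y * (y + c - 2) by rewrite /c; field.
Qed.

Lemma rileyE n y :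
  let x := 2 + y * (y + c - 2) in
  riley n c y = (x + 1 - c - y) * cheb x n - cheb x (n - 1).
Proof. by rewrite /= /riley chebD1; ring. Qed.

Lemma twist_relator_eta n y :
  s * twist_word n s (t y) - twist_word n s (t y) * t y =
  mx2 0 (riley n c y) (- y * riley n c y) 0.
Proof.
rewrite twist_word_eta rileyE /s /t /eta_s /eta_t !mulmx2.
move: (cheb _ _) (cheb _ _) => u v.
by apply: mx2P; rewrite !mxE /= /c; field.
Qed.

Lemma twist_word_unit n y : twist_word n s (t y) \is a GRing.unit.
Proof.
rewrite twist_word_eta; apply: mx2_unit.
rewrite -[RHS](cheb_cassini (2 + y * (y + c - 2)) n).
move: (cheb _ _) (cheb _ _) => u v.
by rewrite /c; field.
Qed.

Lemma is_SL2_rep_eta n y : is_SL2_rep n s (t y) <-> riley n c y = 0.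
Proof.
have Us : t y \is a GRing.unit.
  by rewrite /t /eta_t mx2_unit // mul0r subr0 divff.
have Uw := twist_word_unit n y.
have rel := twist_relator_eta n y.
split=> [[_ _] | r0].
  move/(congr1 (fun X => X * twist_word n s (t y) * t y)).
  rewrite mul1r divrK // divrK // => /eqP; rewrite -subr_eq0 rel => /eqP.
  by move/matrixP/(_ 0 1); rewrite !mxE.
rewrite r0 mulr0 in rel.
split; rewrite ?det_mx2 ?mulr0 ?mul0r ?subr0 ?divff //.
apply: (mulIr Uw); rewrite mul1r divrK //; apply: (mulIr Us).
rewrite divrK //; apply/eqP; rewrite -subr_eq0 rel; apply/eqP.
by apply: mx2P; rewrite !mxE.
Qed.

(** Commuting images force y = 0 and M^-1 = M, hence c = 2, where Riley's polynomial takes the value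
    (n + 1) - n = 1. *)
Lemma nonabelian_eta n y : riley n c y = 0 -> nonabelian_rep s (t y).
Proof.
move=> r0; rewrite /nonabelian_rep /s /t /eta_s /eta_t !mulmx2 => /matrixP st.
have := st 0 0; rewrite !mxE /= => st00.
have y0 : y = 0 by apply: (addrI (M * M)); move: st00; rewrite mul1r !mul0r !addr0.
have := st 0 1; rewrite !mxE /= => st01.
have MM : M^-1 = M by move: st01; rewrite mulr0 add0r mul1r mul0r addr0 mulr1.
have c2 : c = 2 by rewrite /c MM expr2 -{2}MM -{4}MM divff.
have : riley n c y = 1 by rewrite /riley c2 y0 mul0r addr0 !cheb_at2 intrD; ring.
by rewrite r0 => /esym/eqP; rewrite oner_eq0.
Qed.

(** On a root of Riley's polynomial [cheb x (n - 1)] is a multiple of [cheb x n], so L is an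
    explicit multiple of [cheb x n ^+ 2], and the Cassini identity eliminates that square. *)
Lemma longitude_eta n y : riley n c y = 0 ->
  let L := longitude n s (t y) 0 0 in
  y * (1 + L * M ^+ 2) = (M ^+ 2 - 1) * (L - 1).
Proof.
rewrite rileyE /longitude twist_word_eta twist_word_rev_eta mulmx2 mxE /=.
have := cheb_cassini (2 + y * (y + c - 2)) n.
move: (cheb _ _) (cheb _ _) => u v H /eqP; rewrite subr_eq0 => /eqP Ev.
rewrite -Ev in H *; apply: subr0_eq.
move/esym/eqP: H; rewrite -subr_eq0 => /eqP H.
(* The Cassini relation enters with cofactor [M ^+ 2 + y - 1]. *)
by rewrite -[RHS](mulr0 (M ^+ 2 + y - 1)) -H /c; field.
Qed.
End Representations.

(** As [Negz k] is -(k + 1), this is 2n or -2n - 1: the last index of the closed sum, and the degree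
    of Riley's polynomial in y and of the formula in L. *)
Definition riley_deg (n : int) : nat :=
  match n with Posz k => k.*2 | Negz k => k.*2.+1 end.

(* For n < 0 the sign turns the powers of M^2 - 1 into powers of 1 - M^2. *)
Definition twist_bin (n : int) (i : nat) : int :=
  match n with
  | Posz k => 'C(k + i./2, i)%:Z
  | Negz k => (-1) ^+ i * 'C(k + uphalf i, i)%:Z
  end.

Definition twist_sign (n : int) : int := if n is Posz _ then -1 else 1.

Lemma uphalf_riley_deg n : uphalf (riley_deg n) = absz n.
Proof. by case: n => k /=; rewrite ?doubleK ?uphalf_double. Qed.

(** * Binomial sums and the closed formula as a polynomial *)

Section BinomialSums.
Variable R : comNzRingType.
Implicit Types a b e : R.

(** Pascal's rule links the even and the odd sums, so one induction proves both. The bound [N] is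
    free since the extra binomials vanish, which lets the sums for consecutive [k] share a range. *)
Lemma cheb_bin e k N : (k <= N)%N ->
  \sum_(j < N.+1) 'C(k + j, j.*2)%:R * e ^+ j = cheb (2 + e) k.+1 - cheb (2 + e) k /\
  \sum_(j < N) 'C(k + j, j.*2.+1)%:R * e ^+ j = cheb (2 + e) k.
Proof.
elim: k N => [|k IH] N kN.
  rewrite big_ord_recl /= !big1 => [|j _|j _].
  - by rewrite bin0 expr0; split=> //; ring.
  - by rewrite bin_small ?mul0r // add0n; lia.
  by rewrite bin_small ?mul0r // /bump /=; lia.
have odd1 : \sum_(j < N) 'C(k.+1 + j, j.*2.+1)%:R * e ^+ j = cheb (2 + e) k.+1.
  have [_ H2] := IH N (ltnW kN).
  case: N kN H2 => // N kN H2; have [H1 _] := IH N kN.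
  rewrite -[RHS](subrK (cheb (2 + e) k)) -H1 -H2 -big_split /=.
  by apply: eq_bigr => j _; rewrite addSn binS natrD; ring.
split=> //; have [H1 _] := IH N (ltnW kN).
have -> : cheb (2 + e) k.+2 = (2 + e) * cheb (2 + e) k.+1 - cheb (2 + e) k by [].
move: (cheb _ k.+1) (cheb _ k) odd1 H1 => u v odd1 H1.
rewrite big_ord_recl /= bin0.
have -> : \sum_(i < N) 'C(k.+1 + bump 0 i, (bump 0 i).*2)%:R * e ^+ bump 0 i =
  (\sum_(j < N.+1) 'C(k + j, j.*2)%:R * e ^+ j - 1) +
  e * \sum_(j < N) 'C(k.+1 + j, j.*2.+1)%:R * e ^+ j.
  rewrite big_ord_recl /= bin0 expr0 mulr1 [_ + _ - 1]addrAC subrr add0r mulr_sumr -big_split /=.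
  apply: eq_bigr => j _; rewrite /bump /= !add1n doubleS addSn binS natrD addnS addSn exprS.
  by ring.
by rewrite odd1 H1 expr0; ring.
Qed.

Lemma big_ord_double k (F : nat -> R) :
  \sum_(i < k.*2) F i = \sum_(j < k) F j.*2 + \sum_(j < k) F j.*2.+1.
Proof.
elim: k => [|k IH]; first by rewrite !big_ord0 addr0.
by rewrite doubleS !big_ord_recr /= IH; ring.
Qed.

(** Even indices give powers of [a * b] and odd ones an extra factor [b]; splitting by parity leaves
    the two sums of [cheb_bin]. *)
Lemma twist_bin_sum n a b :
  \sum_(i < (riley_deg n).+1) (twist_bin n i)%:~R * a ^+ i./2 * b ^+ uphalf i =
  cheb (2 + a * b) (n + 1) + (b - 1) * cheb (2 + a * b) n.
Proof.
pose F i := (twist_bin n i)%:~R * a ^+ i./2 * b ^+ uphalf i.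
rewrite -/(F _); have FE : \sum_(i < (riley_deg n).+1) F i =
    \sum_(j < (riley_deg n)./2.+1) F j.*2 + \sum_(j < uphalf (riley_deg n)) F j.*2.+1.
  rewrite /riley_deg; case: n @F => k F /=.
    by rewrite uphalf_double doubleK !big_ord_recr big_ord_double /=; ring.
  by rewrite uphalf_double doubleK -[k.*2.+2]/(k.+1.*2) big_ord_double.
rewrite FE {FE}/F; case: n => k.
  have [H1 H2] := cheb_bin (a * b) (leqnn k).
  have -> : k%:Z + 1 = k.+1 by lia.
  move: (cheb _ k.+1) (cheb _ k) H1 H2 => u v H1 H2.
  rewrite /= uphalf_double doubleK mulrBl mul1r addrCA -H1 addrC; congr (_ + _).
    by apply: eq_bigr => j _; rewrite doubleK uphalf_double exprMn mulrA.
  rewrite -[in RHS]H2 mulr_sumr; apply: eq_bigr => j _.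
  by rewrite /= uphalf_double doubleK exprMn exprS; ring.
(* For odd i = 2j + 1, [uphalf i] is j + 1, so odd indices use the sum for [k.+1] and even ones the
   sum for [k]. *)
have [H1 _] := cheb_bin (a * b) (leqnn k).
have [_ H2] := cheb_bin (a * b) (leqnn k.+1).
have -> : Negz k + 1 = - k%:Z by lia.
rewrite chebN NegzE chebN.
move: (cheb _ k.+1) (cheb _ k) H1 H2 => u v H1 H2.
rewrite /= doubleK uphalf_double.
have -> : - v + (b - 1) * - u = (u - v) - b * u by ring.
rewrite -H1; congr (_ + _).
  apply: eq_bigr => j _.
  by rewrite doubleK uphalf_double exprMn -signr_odd odd_double mul1r mulrA.
rewrite -[in RHS]H2 mulr_sumr -sumrN; apply: eq_bigr => j _.
rewrite uphalf_double /= doubleK exprMn exprS -signr_odd odd_double mulr1 mulN1r rmorphN.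
by rewrite addnS addSn exprS; ring.
Qed.

(* The closed formula with the negative powers of M and of 1 + L M^2 cancelled
   against the prefactor. *)
Definition A_value n (L M : R) : R :=
  (twist_sign n)%:~R * \sum_(i < (riley_deg n).+1)
    (twist_bin n i)%:~R * (1 - M ^+ 2) ^+ i * (1 + L * M ^+ 2) ^+ (riley_deg n - i) *
    (L - 1) ^+ i./2 * (L * M ^+ 4 - 1) ^+ uphalf i *
    M ^+ (2 * (absz n - uphalf i)).

End BinomialSums.

Lemma rmorph_A_value (R S : comNzRingType) (f : {rmorphism R -> S}) n L M :
  f (A_value n L M) = A_value n (f L) (f M).
Proof.
rewrite /A_value rmorphM rmorph_int rmorph_sum; congr (_ * _).
apply: eq_bigr => i _.
by rewrite !(rmorphM, rmorphXn, rmorph_int, rmorphB, rmorphD, rmorph1).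
Qed.

(** * Values of the closed formula over a field *)

Section Field.
Variable K : fieldType.
Implicit Types L M y z : K.

(** With D = 1 + L M^2 the hypothesis turns (1 - M^2)(L - 1) into -D y and (1 - M^2)(L M^4 - 1) into
    D (2 - c - y) M^2. Sharing out the i factors 1 - M^2 matches the sums term by term, without
    dividing by D. *)
Lemma A_value_riley n L M y : M != 0 ->
  y * (1 + L * M ^+ 2) = (M ^+ 2 - 1) * (L - 1) ->
  A_value n L M = (twist_sign n)%:~R * M ^+ (2 * absz n) *
    (1 + L * M ^+ 2) ^+ riley_deg n * riley n (M ^+ 2 + M^-1 ^+ 2) y.
Proof.
move=> M0 Hy; set D := 1 + _; set c := M ^+ 2 + _.
have -> : riley n c y = cheb (2 + (- y) * (2 - c - y)) (n + 1) +
    ((2 - c - y) - 1) * cheb (2 + (- y) * (2 - c - y)) n.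
  rewrite /riley; congr (cheb _ _ + _ * cheb _ _); ring.
rewrite -twist_bin_sum /A_value -!mulrA; congr (_ * _).
rewrite !mulr_sumr; apply: eq_bigr => i _.
have i_le : (i <= riley_deg n)%N by rewrite -ltnS.
have Ea : (1 - M ^+ 2) * (L - 1) = D * (- y).
  by rewrite mulrN [D * y]mulrC /D Hy; ring.
have Eb : (1 - M ^+ 2) * (L * M ^+ 4 - 1) = D * (2 - c - y) * M ^+ 2.
  have -> : D * (2 - c - y) * M ^+ 2 = (D * (2 - c) + D * (- y)) * M ^+ 2 by ring.
  by rewrite -Ea /D /c; field.
have h_le : (uphalf i <= absz n)%N by rewrite -uphalf_riley_deg uphalfE uphalfE half_leq.
have -> : (1 - M ^+ 2) ^+ i = (1 - M ^+ 2) ^+ i./2 * (1 - M ^+ 2) ^+ uphalf i.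
  by rewrite -exprD addnC uphalf_half -addnA addnn odd_double_half.
have -> : D ^+ riley_deg n = D ^+ (riley_deg n - i) * (D ^+ i./2 * D ^+ uphalf i).
  rewrite -!exprD; congr (_ ^+ _).
  by rewrite [(i./2 + _)%N]addnC uphalf_half -addnA addnn odd_double_half subnK.
have -> : M ^+ (2 * absz n) = M ^+ (2 * (absz n - uphalf i)) * (M ^+ 2) ^+ uphalf i.
  by rewrite -exprM -exprD -mulnDr subnK.
transitivity ((twist_bin n i)%:~R * ((1 - M ^+ 2) * (L - 1)) ^+ i./2 *
  ((1 - M ^+ 2) * (L * M ^+ 4 - 1)) ^+ uphalf i * D ^+ (riley_deg n - i) *
  M ^+ (2 * (absz n - uphalf i))).
  by rewrite !exprMn; ring.
by rewrite Ea Eb !exprMn; ring.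
Qed.

(** The combination kills the solution z^n of the recursion and leaves z^-n; unlike the quotient
    formula for [cheb], it covers z = z^-1. *)
Lemma cheb_geom z n : z != 0 -> cheb (z + z^-1) (n + 1) - z * cheb (z + z^-1) n = z ^ (- n).
Proof.
move=> z0; elim/int_rect: n => [|n IH|n IH].
- by rewrite oppr0 expr0z /=; ring.
- have -> : n.+1%:Z = n%:Z + 1 by lia.
  rewrite chebD1 addrK opprD expfzDr // exprN1 -IH.
  by rewrite !chebD1; field.
have -> : - n.+1%:Z = - n%:Z - 1 by lia.
have -> : - (- n%:Z - 1) = - (- n%:Z) + 1 by lia.
rewrite subrK [cheb _ (_ - 1)]chebB1 expfzDr // expr1z -IH.
by field.
Qed.

Definition A_lead_deg (n : int) : nat :=
  match n with Posz k => 4 * k | Negz k => 8 * k + 6 end.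

(** Up to sign this is the coefficient of the top power of L, each factor of the summand being
    replaced by its own top coefficient. For the chosen [a] and [b], 2 + a b = M^2 + M^-2, and
    [cheb_geom] at z = M^2 collapses the sum. *)
Lemma A_lead_sum n M : M != 0 ->
  \sum_(i < (riley_deg n).+1)
    (twist_bin n i)%:~R * (1 - M ^+ 2) ^+ i * (M ^+ 2) ^+ (riley_deg n - i) *
    1 ^+ i./2 * (M ^+ 4) ^+ uphalf i * M ^+ (2 * (absz n - uphalf i)) =
  M ^+ A_lead_deg n.
Proof.
move=> M0; pose a := (1 - M ^+ 2) * M ^- 2; pose b := 1 - M ^+ 2.
transitivity (M ^+ (2 * absz n + 2 * riley_deg n) *
    (cheb (2 + a * b) (n + 1) + (b - 1) * cheb (2 + a * b) n)).
  rewrite -twist_bin_sum mulr_sumr; apply: eq_bigr => i _.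
  have i_le : (i <= riley_deg n)%N by rewrite -ltnS.
  have h_le : (uphalf i <= absz n)%N by rewrite -uphalf_riley_deg uphalfE uphalfE half_leq.
  have -> : (1 - M ^+ 2) ^+ i = a ^+ i./2 * (M ^+ 2) ^+ i./2 * b ^+ uphalf i.
    rewrite -exprMn /a mulfVK ?expf_neq0 // -exprD.
    by rewrite addnC uphalf_half -addnA addnn odd_double_half.
  have -> : M ^+ (2 * absz n + 2 * riley_deg n) =
     (M ^+ 2) ^+ (riley_deg n - i) * (M ^+ 4) ^+ uphalf i *
     M ^+ (2 * (absz n - uphalf i)) * (M ^+ 2) ^+ i./2.
    rewrite -!exprM -!exprD; congr (_ ^+ _).
    by move: (odd_double_half i) i_le h_le; rewrite uphalf_half; lia.
  by rewrite expr1n; ring.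
have -> : 2 + a * b = M ^+ 2 + M ^- 2 by rewrite /a /b; field.
have -> : b - 1 = - M ^+ 2 by rewrite /b; ring.
rewrite mulNr cheb_geom ?expf_neq0 //; case: n => k.
  rewrite -exprz_inv -exprnP exprVn /= -exprM; apply: (canLR (mulfK _)); rewrite ?expf_neq0 //.
  by rewrite -exprD; congr (_ ^+ _); lia.
by rewrite NegzE opprK -exprnP /= -exprM -exprD; congr (_ ^+ _); lia.
Qed.

(** At M = 0 only indices with [uphalf i = absz n] survive: 2n - 1 and 2n with equal signs if n > 0,
    a single one otherwise. L = 2 makes L - 1 equal to 1, so the value is +-2 or +-1. Hence M does
    not divide the formula. *)
Lemma A_value_2_0 n : (2 : K) != 0 -> A_value n 2 (0 : K) != 0.
Proof.
move=> ch2; rewrite /A_value mulf_neq0 //.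
  by case: n => k; rewrite ?rmorphN ?oppr_eq0 oner_neq0.
have e2 : (2 - 1 : K) = 1 by ring.
rewrite e2 !expr0n /= !mulr0 subr0 addr0 sub0r.
pose F i : K := (twist_bin n i)%:~R * 1 ^+ i * 1 ^+ (riley_deg n - i) *
    1 ^+ i./2 * (-1) ^+ uphalf i * 0 ^+ (2 * (absz n - uphalf i)).
rewrite -[X in X != 0]/(\sum_(i < (riley_deg n).+1) F i).
have small k : absz n = k.+1 -> \sum_(i < k.*2.+1) F i = 0.
  move=> nk; apply: big1 => i _; rewrite /F nk expr0n.
  have -> : (2 * (k.+1 - uphalf i) == 0)%N = false.
    by have := ltn_ord i; move: (odd_double_half i); rewrite uphalf_half; lia.
  by rewrite mulr0.
case: n @F small => [[|k]|k] F small.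
- by rewrite big_ord_recl big_ord0 /F /= !expr0 !mulr1 addr0 oner_neq0.
- have -> : (riley_deg k.+1).+1 = k.*2.+3 by rewrite /= doubleS.
  rewrite 2!big_ord_recr /= small // /F /= uphalf_double doubleK.
  rewrite addSn addnn binn addnS !expr1n !mulr1 subnn expr0 add0r !mulr1 -mulrDl.
  rewrite addSn addnn binn mulf_neq0 ?signr_eq0 //.
rewrite big_ord_recr /= small // /F /= uphalf_double ?doubleK.
rewrite addnS addnn binn subnn expr0 !expr1n add0r !mulr1 rmorphXn rmorphN1.
by rewrite subnn expr0 mulr1 mulf_neq0 ?signr_eq0.
Qed.

End Field.

(** * Riley's polynomial is monic in y *)

Section RileyMonic.
Variable R : idomainType.

Lemma chebn_monic (p : {poly R}) k : p \is monic -> size p = 3%N ->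
  chebn p k.+1 \is monic /\ size (chebn p k.+1) = k.*2.+1.
Proof.
move=> pm p3; elim/ltn_ind: k => -[|[|k]] IH.
- by rewrite /= monic1 size_poly1.
- by rewrite /= mulr1 subr0.
have [m1 s1] := IH k.+1 (ltnSn _); have [m0 s0] := IH k (ltnW (ltnSn _)).
have s : size (p * chebn p k.+2) = k.*2.+1.+4 by rewrite size_monicM ?monic_neq0 // p3 s1.
have lt : (size (- chebn p k.+1)%R < size (p * chebn p k.+2)%R)%N.
  by rewrite s size_polyN s0; lia.
rewrite chebnSS; split; last by rewrite size_polyDl // s; lia.
by rewrite monicE lead_coefDl // -monicE monicMl.
Qed.

(** For n >= 0 the term at n + 1 dominates. For n < 0 the product with 1 - c - y does, and the sign
    of [cheb] at a negative index cancels that of -y. *)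
Lemma riley_monic n (c : R) :
  riley n c%:P 'X \is monic /\ size (riley n c%:P 'X) = (riley_deg n).+1.
Proof.
rewrite /riley; set p := 2 + _; set q := 1 - c%:P - 'X.
have [pm p3] : p \is monic /\ size p = 3%N.
  have -> : p = 'X * ('X - (2 - c)%:P) + 2%:P.
    by rewrite /p polyCB -[2%:P]/(2%:R%:P) polyCMn; ring.
  have s3 : size ('X * ('X - (2 - c)%:P)) = 3%N.
    by rewrite size_monicM ?monicX ?polyXsubC_eq0 // size_polyX size_XsubC.
  have lt : (size (2%:P : {poly R}) < size ('X * ('X - (2 - c)%:P))%R)%N.
    by rewrite s3 (leq_ltn_trans (size_polyC_leq1 _)).
  by rewrite size_polyDl // monicE lead_coefDl // -monicE monicMr ?monicX ?monicXsubC.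
have qE : - q = 'X - (1 - c)%:P by rewrite /q polyCB polyC1; ring.
have sq : size q = 2.
  by rewrite -size_polyN qE size_XsubC.
case: n => [[|k]|k].
- by rewrite /= mulr0 addr0 monic1 size_poly1.
- have [m1 s1] := chebn_monic k.+1 pm p3; have [m0 s0] := chebn_monic k pm p3.
  have -> : k.+1%:Z + 1 = k.+2 by lia.
  rewrite /cheb.
  have lt : (size (q * chebn p k.+1)%R < size (chebn p k.+2))%N.
    by rewrite s1 (leq_ltn_trans (size_polyMleq _ _)) // sq s0.
  by rewrite size_polyDl // monicE lead_coefDl // -monicE s1.
have -> : Negz k + 1 = - k%:Z by lia.
rewrite NegzE !chebN /cheb mulrN -mulNr.
have [m1 s1] := chebn_monic k pm p3.
have s : size (- q * chebn p k.+1) = k.*2.+2.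
  by rewrite qE size_monicM ?monicXsubC ?monic_neq0 // size_XsubC s1.
have lt : (size (- chebn p k)%R < size (- q * chebn p k.+1)%R)%N.
  rewrite s size_polyN; case: k {m1 s1 s} => [|k]; first by rewrite /= size_poly0.
  by have [_ ->] := chebn_monic k pm p3; lia.
rewrite addrC size_polyDl // monicE lead_coefDl // -monicE s.
by rewrite qE monicMr ?monicXsubC.
Qed.

End RileyMonic.

(** * Absence of double roots at c = -2 *)

Lemma cheb_sqr_sub2 (R : comNzRingType) (v : R) (n : int) :
  v * cheb (v ^+ 2 - 2) n = cheb v (n * 2) /\
  cheb (v ^+ 2 - 2) (n + 1) + cheb (v ^+ 2 - 2) n = cheb v (n * 2 + 1).
Proof.
(* For v = z + z^-1 one has v^2 - 2 = z^2 + z^-2, so this is angle doubling; each identity feeds the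
   induction step of the other. *)
elim/int_rect: n => [|n [IH1 IH2]|n [IH1 IH2]].
- by rewrite mul0r /= mulr0 addr0.
- have -> : n.+1%:Z = n%:Z + 1 by lia.
  have -> : (n%:Z + 1) * 2 = n%:Z * 2 + 1 + 1 by lia.
  rewrite [cheb v (_ + 1 + 1 + 1)]chebD1 addrK [cheb v (_ + 1 + 1)]chebD1 addrK -IH1 -IH2.
  rewrite [cheb _ (_ + 1 + 1)]chebD1 addrK; split; ring.
have -> : - n.+1%:Z = - n%:Z - 1 by lia.
have -> : (- n%:Z - 1) * 2 = - n%:Z * 2 - 1 - 1 by lia.
rewrite !subrK [cheb v (_ - 1 - 1)]chebB1 subrK [cheb v (_ - 1)]chebB1 -IH1 -IH2.
rewrite [cheb _ (- n%:Z - 1)]chebB1; split; ring.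
Qed.

(* c = -2 is M = i, where the representations are dihedral. *)
Lemma riley_dihedral (R : comNzRingType) (v : R) (n : int) :
  riley n (- 2) (2 - v) = cheb v (n * 2 + 1) + cheb v (n * 2).
Proof.
have [<- <-] := cheb_sqr_sub2 v n; rewrite /riley.
have -> : 2 + (2 - v) * (2 - v + - 2 - 2) = v ^+ 2 - 2 by ring.
by ring.
Qed.

(** For v = 2 cos t this is sin((k + 1/2) t) / sin(t / 2), the Chebyshev polynomial of the fourth
    kind. *)
Definition cheb_half (R : comNzRingType) (v : R) (k : int) : R :=
  cheb v (k + 1) + cheb v k.

Lemma cheb_halfD1 (R : comNzRingType) (v : R) k :
  cheb_half v (k + 1) = v * cheb_half v k - cheb_half v (k - 1).
Proof.
by rewrite /cheb_half [cheb _ (_ + 1 + 1)]chebD1 addrK subrK [cheb _ (k - 1)]chebB1; ring.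
Qed.

Lemma cheb_halfB1 (R : comNzRingType) (v : R) k :
  cheb_half v (k - 1) = v * cheb_half v k - cheb_half v (k + 1).
Proof. by rewrite cheb_halfD1; ring. Qed.

(** Such a first-order relation replaces any description of the roots. A companion relation for the
    index k + 1 is proved along with it, because the recursion has order two. *)
Lemma deriv_cheb_half (R : comNzRingType) (k : int) :
  let V := cheb_half ('X : {poly R}) in
  ('X ^+ 2 - 4) * (V k)^`() = (2 * k + 1)%:~R * V (k + 1) - (1 + (k + 1)%:~R * 'X) * V k.
Proof.
move=> V.
suff [] : ('X ^+ 2 - 4) * (V k)^`() = (2 * k + 1)%:~R * V (k + 1) - (1 + (k + 1)%:~R * 'X) * V k
 /\ ('X ^+ 2 - 4) * (V (k + 1))^`() = ((k + 1)%:~R * 'X - 1) * V (k + 1) - (2 * k + 3)%:~R * V k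
  by [].
have VD j : V (j + 1) = 'X * V j - V (j - 1) by apply: cheb_halfD1.
have VB j : V (j - 1) = 'X * V j - V (j + 1) by apply: cheb_halfB1.
elim/int_rect: k => [|n [IH1 IH2]|n [IH1 IH2]].
- have V0 : V 0 = 1 by rewrite /V /cheb_half /= addr0.
  have V1 : V (0 + 1) = 'X + 1 by rewrite /V /cheb_half /= mulr1 subr0.
  by rewrite V1 V0 derivD derivX derivC; split; ring.
- have -> : n.+1%:Z = n%:Z + 1 by lia.
  rewrite [V (_ + 1 + 1)]VD addrK derivB derivM derivX mul1r.
  split; first by rewrite IH2 !intrD !intrM !intrD; ring.
  transitivity (('X ^+ 2 - 4) * V (n%:Z + 1) + 'X * (('X ^+ 2 - 4) * (V (n%:Z + 1))^`())
    - ('X ^+ 2 - 4) * (V n)^`()); first by ring.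
  by rewrite IH1 IH2 !intrD !intrM !intrD; ring.
have -> : - n.+1%:Z = - n%:Z - 1 by lia.
rewrite !subrK [V (_ - 1)]VB derivB derivM derivX mul1r.
split; last by rewrite IH1 !(intrB, intrD, intrM, rmorphN); ring.
transitivity (('X ^+ 2 - 4) * V (- n%:Z) + 'X * (('X ^+ 2 - 4) * (V (- n%:Z))^`())
  - ('X ^+ 2 - 4) * (V (- n%:Z + 1))^`()); first by ring.
by rewrite IH1 IH2 !(intrB, intrD, intrM, rmorphN); ring.
Qed.

(** * Distinct eigenvalues L at generic M *)

Section Generic.
Variable C : numClosedFieldType.

(** At a double root the derivative relation leaves (2k + 1) V(k + 1) = 0 with 2k + 1 odd. Two
    consecutive terms then vanish, hence all of them, against V(0) = 1. *)
Lemma cheb_half_no_double_root (k : int) (v : C) :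
  root (cheb_half 'X k) v -> ~~ root (cheb_half 'X k)^`() v.
Proof.
have ev j : (cheb_half 'X j).[v] = cheb_half v j.
  by rewrite /cheb_half hornerD -!horner_evalE !rmorph_cheb /= horner_evalE hornerX.
move=> /rootP; rewrite ev => Vk; apply/negP => /rootP dVk.
have := congr1 (horner^~ v) (deriv_cheb_half C k).
rewrite /= hornerM dVk mulr0 hornerD hornerN !hornerM !ev Vk mulr0 subr0.
rewrite -[_%:~R.[v]]horner_evalE rmorph_int.
move/esym/eqP; rewrite mulf_eq0 intr_eq0 => /orP[/eqP|/eqP Vk1]; first by lia.
have V0 j : cheb_half v (k + j) = 0.
  suff: cheb_half v (k + j) = 0 /\ cheb_half v (k + j + 1) = 0 by case.
  elim/int_rect: j => [|n [IH1 IH2]|n [IH1 IH2]]; first by rewrite addr0.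
    have -> : n.+1%:Z = n%:Z + 1 by lia.
    by rewrite addrA [cheb_half _ (_ + 1 + 1)]cheb_halfD1 addrK IH1 IH2 mulr0 subr0.
  have -> : - n.+1%:Z = - n%:Z - 1 by lia.
  by rewrite addrA subrK [cheb_half _ (_ - 1)]cheb_halfB1 IH1 IH2 mulr0 subr0.
have := V0 (- k); rewrite subrr /cheb_half /= addr0 => /eqP.
by rewrite oner_eq0.
Qed.

Lemma riley_dihedral_coprime n :
  coprimep (riley n (- 2)%:P 'X) (riley n (- 2)%:P 'X : {poly C})^`().
Proof.
have -> : riley n (- 2)%:P 'X = cheb_half 'X (n * 2) \Po (2%:P - 'X) :> {poly C}.
  rewrite /cheb_half rmorphD /= !(rmorph_cheb (comp_poly _)) /= comp_polyX.
  rewrite -riley_dihedral polyCN !polyCMn !polyC1; congr riley; ring.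
apply: Pdiv.ClosedField.root_coprimep => v; rewrite /root horner_comp deriv_comp hornerM horner_comp.
move=> /cheb_half_no_double_root r; rewrite mulf_neq0 //.
by rewrite derivB derivC derivX sub0r hornerN hornerC oppr_eq0 oner_eq0.
Qed.

(* The discriminant in y does not vanish at c = -2, hence only finitely many c
   are excluded. *)
Lemma riley_generic n : exists2 D : {poly C}, D != 0 &
  forall c, D.[c] != 0 -> exists ys : seq C,
    [/\ uniq ys, size ys = riley_deg n & forall y, y \in ys -> riley n c y = 0].
Proof.
have [n0|n0] := eqVneq (riley_deg n) 0.
  by exists 1; rewrite ?oner_neq0 // => c _; exists [::].
pose P : {poly {poly C}} := riley n 'Y 'X.
have evP c : map_poly (horner_eval c) P = riley n c%:P 'X.
  by rewrite rmorph_riley /= map_polyC map_polyX /= horner_evalE hornerX.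
have [Pm Ps] := riley_monic n ('X : {poly C}).
have ldP : lead_coef P^`() = (riley_deg n)%:R.
  have lP : P`_(riley_deg n) = 1 by have := monicP Pm; rewrite /lead_coef Ps.
  rewrite /deriv Ps /= lead_coef_poly ?prednK ?lt0n ?lP //.
  by rewrite -polyCMn polyC_eq0 pnatr_eq0.
(* Evaluation at c commutes with the resultant because the leading coefficients, 1 and
   [riley_deg n], do not vanish; this is why degree 0 was set apart. *)
have Dc c : (resultant P P^`()).[c] = resultant (riley n c%:P 'X) (riley n c%:P 'X)^`().
  rewrite -evP deriv_map -horner_evalE map_resultant // ?ldP.
    by rewrite (monicP Pm) /= horner_evalE hornerC oner_eq0.
  by rewrite /= horner_evalE hornerMn hornerC pnatr_eq0.
exists (resultant P P^`()).
  apply/eqP => D0; have := Dc (- 2); rewrite D0 horner0 => /esym/eqP.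
  rewrite resultant_eq0; have := riley_dihedral_coprime n.
  by rewrite /coprimep => /eqP ->.
move=> c; rewrite Dc resultant_eq0 -leqNgt => sc.
have [rm rs] := riley_monic n c.
have [ys ysE] := closed_field_poly_normal (riley n c%:P 'X).
rewrite (monicP rm) scale1r in ysE.
exists ys; split.
- rewrite -separable_prod_XsubC -ysE unlock /separable_poly /coprimep.
  rewrite eqn_leq sc size_poly_gt0 gcdp_eq0 negb_and monic_neq0 //.
- by have := rs; rewrite ysE size_prod_XsubC => -[].
move=> y yys; have : root (riley n c%:P 'X) y by rewrite ysE root_prod_XsubC.
by move/rootP; rewrite -horner_evalE rmorph_riley /= !horner_evalE hornerC hornerX.
Qed.

(** Two roots y with the same L force 1 + L M^2 = 0, and then (M^2 - 1)(L - 1) = 0 gives M^4 = 1. So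
    [G] excludes M = 0, M^4 = 1 and, through the factors [F c], the M for which M^2 + M^-2 is a root
    of [D]. *)
Lemma eigenvalue_pair_generic n : exists2 G : {poly C}, G != 0 &
  forall M, G.[M] != 0 -> exists Ls : seq C,
    [/\ uniq Ls, size Ls = riley_deg n & forall L, L \in Ls -> eigenvalue_pair n L M].
Proof.
have [D D0 HD] := riley_generic n.
have [cs csE] := closed_field_poly_normal D.
pose F (c : C) : {poly C} := 'X^4 - c%:P * 'X^2 + 1.
have Fev c M : M != 0 -> (F c).[M] = M ^+ 2 * (M ^+ 2 + M^-1 ^+ 2 - c).
  by move=> M0; rewrite /F !hornerE /=; field.
exists ('X * ('X^4 - 1) * \prod_(c <- cs) F c).
  have nz (p : {poly C}) : p.[0] != 0 -> p != 0.
    by apply: contraNneq => ->; rewrite horner0.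
  rewrite !mulf_neq0 ?polyX_eq0 //.
    by apply: nz; rewrite !hornerE expr0n sub0r oppr_eq0 oner_eq0.
  rewrite prodf_seq_neq0; apply/allP => c _; apply: nz.
  by rewrite /F !hornerE !expr0n /= ?mulr0 ?oppr0 ?add0r ?addr0 oner_eq0.
move=> M; rewrite !hornerM hornerX horner_prod !mulf_eq0 !negb_or => /andP[/andP[M0 M4] HF].
have [|ys [ysu yss ysr]] := HD (M ^+ 2 + M^-1 ^+ 2).
  rewrite csE hornerZ mulf_neq0 ?lead_coef_eq0 // horner_prod prodf_seq_neq0.
  apply/allP => c cin /=; rewrite hornerXsubC.
  move: HF; rewrite prodf_seq_neq0 => /allP/(_ c cin) /=.
  by rewrite Fev // mulf_eq0 negb_or => /andP[].
pose L y := longitude n (eta_s M) (eta_t M y) 0 0.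
exists (map L ys); split; rewrite ?size_map //.
  rewrite map_inj_in_uniq // => y y' yin yin' LL.
  have E x : x \in ys -> x * (1 + L x * M ^+ 2) = (M ^+ 2 - 1) * (L x - 1).
    by move=> xin; apply: longitude_eta (ysr x xin).
  have := E y yin; rewrite LL; have := E y' yin'; move: (L y') => l E'.
  rewrite -{1}E' => /eqP; rewrite -subr_eq0 -mulrBl mulf_eq0 subr_eq0.
  case/orP => [/eqP // | /eqP l0].
  have M4E : M ^+ 4 = (M ^+ 2) ^+ 2 by rewrite -exprM.
  move: E' M4; rewrite l0 mulr0 => /esym/eqP.
  rewrite mulf_eq0 !subr_eq0 => /orP[/eqP M2 | /eqP l1].
    by rewrite !hornerE /= M4E M2 expr1n subrr eqxx.
  have M2 : M ^+ 2 = - 1 by apply/eqP; rewrite -addr_eq0 addrC -l0 l1 mul1r.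
  by rewrite !hornerE /= M4E M2 sqrrN expr1n subrr eqxx.
move=> _ /mapP[y yin ->]; split=> //; exists y; split=> //.
  by apply/is_SL2_rep_eta => //; apply: ysr.
by apply: (nonabelian_eta M0) (ysr y yin).
Qed.

End Generic.

(** * Leading coefficient in L *)

Section TopCoefficient.
Variable R : idomainType.
Implicit Types p q : {poly R}.

(** Allowing [l] to be zero makes the notion stable under products and sums without any nonvanishing
    condition. *)
Definition top_coef d p l := (size p <= d.+1)%N /\ p`_d = l.

Lemma top_coefC c : top_coef 0 c%:P c.
Proof. by rewrite /top_coef coefC size_polyC_leq1. Qed.

Lemma top_coef_linear a b : top_coef 1 ('X * a%:P + b%:P) a.
Proof.
split; last by rewrite coefD coefXM !coefC /= addr0.
by rewrite mulrC size_MXaddC; case: ifP => // _; rewrite ltnS size_polyC_leq1.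
Qed.

Lemma top_coefM d e p q k l :
  top_coef d p k -> top_coef e q l -> top_coef (d + e) (p * q) (k * l).
Proof.
move=> [sp <-] [sq <-]; split.
  apply: leq_trans (size_polyMleq _ _) _; rewrite -subn1.
  by apply: leq_trans (leq_sub2r 1 (leq_add sp sq)) _; rewrite subn1 addSn addnS.
have de : (d < (d + e).+1)%N by lia.
rewrite coefM (bigD1 (Ordinal de)) //= addKn big1 ?addr0 // => j.
rewrite -val_eqE /= neq_ltn => /orP[lt | lt].
  by rewrite [q`_(_)]nth_default ?mulr0 //; apply: leq_trans sq _; lia.
by rewrite [p`_(_)]nth_default ?mul0r //; apply: leq_trans sp _.
Qed.

Lemma top_coefX d p k n : top_coef d p k -> top_coef (d * n) (p ^+ n) (k ^+ n).
Proof.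
move=> h; elim: n => [|n IH]; first by rewrite muln0 !expr0; apply: top_coefC.
by rewrite mulnS !exprS; apply: top_coefM.
Qed.

Lemma top_coef_sum d n (p : nat -> {poly R}) (k : nat -> R) :
  (forall i, (i < n)%N -> top_coef d (p i) (k i)) ->
  top_coef d (\sum_(i < n) p i) (\sum_(i < n) k i).
Proof.
move=> h; split.
  by apply: leq_trans (size_sum _ _ _) _; apply/bigmax_leqP => i _; case: (h i).
by rewrite coef_sum; apply: eq_bigr => i _; case: (h i).
Qed.

End TopCoefficient.

Lemma A_value_top (R : idomainType) n (m : R) :
  top_coef (riley_deg n) (A_value n 'X m%:P)
   ((twist_sign n)%:~R * \sum_(i < (riley_deg n).+1)
     (twist_bin n i)%:~R * (1 - m ^+ 2) ^+ i * (m ^+ 2) ^+ (riley_deg n - i) *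
     1 ^+ i./2 * (m ^+ 4) ^+ uphalf i * m ^+ (2 * (absz n - uphalf i))).
Proof.
have tZ (z : int) : top_coef 0 (z%:~R : {poly R}) z%:~R.
  by rewrite -(rmorph_int polyC); apply: top_coefC.
rewrite /A_value; apply: (@top_coefM _ 0 (riley_deg n)) => //.
pose p i := (twist_bin n i)%:~R * (1 - m%:P ^+ 2) ^+ i * (1 + 'X * m%:P ^+ 2) ^+ (riley_deg n - i) *
    ('X - 1) ^+ i./2 * ('X * m%:P ^+ 4 - 1) ^+ uphalf i *
    m%:P ^+ (2 * (absz n - uphalf i)) : {poly R}.
pose k i := (twist_bin n i)%:~R * (1 - m ^+ 2) ^+ i * (m ^+ 2) ^+ (riley_deg n - i) *
    1 ^+ i./2 * (m ^+ 4) ^+ uphalf i * m ^+ (2 * (absz n - uphalf i)).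
apply: (top_coef_sum (p := p) (k := k)) => i ile; rewrite {}/p {}/k.
(* The degrees of the six factors in turn; only the three factors linear in L contribute, and their
   total does not depend on i. *)
have dE : riley_deg n = (0 + 0 * i + 1 * (riley_deg n - i) + 1 * i./2 + 1 * uphalf i +
    0 * (2 * (absz n - uphalf i)))%N.
  by move: (odd_double_half i) ile; rewrite uphalf_half; lia.
have -> : 1 + 'X * m%:P ^+ 2 = 'X * (m ^+ 2)%:P + 1%:P by rewrite addrC rmorphXn.
rewrite {1}dE.
have -> : 'X - 1 = 'X * 1%:P + (- 1)%:P :> {poly R} by rewrite polyCN polyC1 mulr1.
have -> : 'X * m%:P ^+ 4 - 1 = 'X * (m ^+ 4)%:P + (- 1)%:P.
  by rewrite polyCN polyC1 rmorphXn.
have -> : 1 - m%:P ^+ 2 = (1 - m ^+ 2)%:P by rewrite polyCB polyC1 rmorphXn.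
by do 5?[apply: top_coefM; last by apply: top_coefX;
  first [apply: top_coefC | apply: top_coef_linear]].
Qed.

(** * The integral polynomial and its agreement with the closed formula *)

Definition A_poly n : {poly {poly int}} := A_value n 'X 'Y.

Lemma tofrac_A_poly n : tofrac (A_poly n) = A_value n fracL fracM.
Proof. by rewrite (rmorph_A_value (@tofrac {poly {poly int}})). Qed.

Lemma A_poly_top n :
  top_coef (riley_deg n) (A_poly n) ((twist_sign n)%:~R * 'X^(A_lead_deg n)).
Proof.
have := A_value_top n ('X : {poly int}); congr (top_coef _ _ (_ * _)).
(* The coefficients are compared in the fraction field because [A_lead_sum] is stated over a
   field. *)
apply/eqP; rewrite -tofrac_eq; apply/eqP; rewrite rmorph_sum rmorphXn.
have X0 : tofrac ('X : {poly int}) != 0 by rewrite tofrac_eq0 polyX_eq0.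
rewrite -(A_lead_sum n X0); apply: eq_bigr => i _.
by rewrite !(rmorphM, rmorphXn, rmorphB, rmorph1, rmorph_int).
Qed.

Lemma A_value_frac (F : fieldType) n (L M : F) : M != 0 -> 1 + L * M ^+ 2 != 0 ->
  A_value n L M = (twist_sign n)%:~R * M ^+ (2 * absz n) * (1 + L * M ^+ 2) ^+ riley_deg n *
  \sum_(i < (riley_deg n).+1) (twist_bin n i)%:~R * (1 - M ^+ 2) ^+ i *
    (1 + L * M ^+ 2) ^- i * (L - 1) ^+ i./2 * (L * M ^+ 2 - M ^- 2) ^+ uphalf i.
Proof.
move=> M0 D0; rewrite /A_value -!mulrA; congr (_ * _).
rewrite !mulr_sumr; apply: eq_bigr => i _.
have i_le : (i <= riley_deg n)%N by rewrite -ltnS.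
have h_le : (uphalf i <= absz n)%N by rewrite -uphalf_riley_deg uphalfE uphalfE half_leq.
set D := 1 + L * _ in D0 *.
have -> : D ^+ riley_deg n = D ^+ (riley_deg n - i) * D ^+ i by rewrite -exprD subnK.
have -> : M ^+ (2 * absz n) = M ^+ (2 * (absz n - uphalf i)) * (M ^+ 2) ^+ uphalf i.
  by rewrite -exprM -exprD -mulnDr subnK.
have -> : (L * M ^+ 4 - 1) ^+ uphalf i = (M ^+ 2) ^+ uphalf i * (L * M ^+ 2 - M ^- 2) ^+ uphalf i.
  by rewrite -exprMn; congr (_ ^+ _); field.
have Di : D ^+ i != 0 by rewrite expf_neq0.
move: (D ^+ i) (_ ^+ (riley_deg n - i)) (L * M ^+ 2 - M ^- 2) Di => d d' e d0.
by field.
Qed.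

Lemma tofrac_A_poly_formula n : tofrac (A_poly n) = twist_formula n.
Proof.
have M0 : fracM != 0 by rewrite tofrac_eq0 polyC_eq0 polyX_eq0.
have D0 : 1 + fracL * fracM ^+ 2 != 0.
  rewrite -tofrac1 -tofracXn -tofracM -tofracD tofrac_eq0.
  apply: contra_neqN (oner_neq0 int) => /eqP/(congr1 (fun p => p.[0, 0])).
  by rewrite !hornerE /= => ->.
rewrite tofrac_A_poly A_value_frac // /twist_formula.
move: fracL fracM M0 D0 => L M M0 D0.
have M2 : M ^ 2 = M ^+ 2 by [].
have M2V : M ^ (- 2) = M ^- 2 by [].
rewrite M2 M2V; case: n => k.
  rewrite lez_nat leq0n big_mkord /= mulN1r.
  have -> : 2 * k%:Z = (2 * k)%N by lia.
  by rewrite -!exprnP mul2n; congr (_ * _ * _).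
have -> : (0 <= Negz k) = false by [].
have -> : - 2 * Negz k = (2 * k.+1)%N by lia.
have -> : (2 * k.+1)%N%:Z - 1 = k.*2.+1%:Z by lia.
rewrite big_mkord -!exprnP mul1r /riley_deg; congr (_ * _); apply: eq_bigr => i _.
(* The floor of (i - 1) / 2 is [uphalf i] - 1, also at i = 0 where it is -1, and [- Negz k] is k +
   1. *)
have -> : absz (- Negz k + ((i%:Z - 1) %/ 2)%Z) = (k + uphalf i)%N.
  by move: (odd_double_half i); rewrite uphalf_half; case: (odd i); lia.
rewrite /twist_bin rmorphM rmorphXn rmorphN1 /=.
have -> : (M ^+ 2 - 1) ^+ i = (-1) ^+ i * (1 - M ^+ 2) ^+ i.
  by rewrite -exprMn; congr (_ ^+ _); ring.
by congr (_ / _ * _ * _); rewrite [RHS]mulrCA mulrA.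
Qed.
Lemma twist_sign_sqr (R : pzRingType) n :
  (twist_sign n)%:~R * (twist_sign n)%:~R = 1 :> R.
Proof. by case: n => k; rewrite -intrM. Qed.

(** * Divisibility and squarefreeness *)

Section Main.
Variables (C : numClosedFieldType) (n : int).
Implicit Types (L M : C) (p q : {poly {poly C}}).

Let A : {poly {poly C}} := A_value n 'X 'Y.

Lemma polyZ_to_A_poly : polyZ_to C (A_poly n) = A.
Proof.
rewrite /polyZ_to /A_poly (rmorph_A_value (map_poly (map_poly intr))).
by rewrite /A /= map_polyX map_polyC /= map_polyX.
Qed.

Lemma horner_A_poly L M : A.[L, M] = A_value n L M.
Proof.
rewrite -[_.[L, M]]/(horner_eval M (horner_eval L%:P A)).
by rewrite !rmorph_A_value /= !horner_evalE !hornerE.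
Qed.

Lemma horner_map_eval p L M : (map_poly (horner_eval M) p).[L] = p.[L, M].
Proof. by rewrite -horner_swapXY horner2_swapXY. Qed.

Lemma eigenvalue_pair_A_value L M : eigenvalue_pair n L M -> A_value n L M = 0.
Proof.
move=> [M0 [y [/(is_SL2_rep_eta M0) r0 _ ->]]].
by rewrite (A_value_riley _ M0 (longitude_eta M0 r0)) r0 mulr0.
Qed.

Lemma polyZ_A_top : top_coef (riley_deg n) A ((twist_sign n)%:~R * 'X^(A_lead_deg n)).
Proof.
have [s l] := A_poly_top n; rewrite -polyZ_to_A_poly /polyZ_to.
split; first by rewrite (leq_trans (size_poly _ _)).
by rewrite coef_map l /= rmorphM rmorph_int /= map_polyXn.
Qed.

Lemma polyZ_A_lead_neq0 M : M != 0 -> ((twist_sign n)%:~R * 'X^(A_lead_deg n)).[M] != 0.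
Proof.
move=> M0; rewrite hornerM hornerXn mulf_neq0 ?expf_neq0 //.
rewrite -horner_evalE rmorph_int; apply: contraTneq (oner_neq0 C) => s0.
by rewrite -(twist_sign_sqr C n) s0 mul0r eqxx.
Qed.

Lemma poly_eq0_generic p :
  (exists2 G : {poly C}, G != 0 & forall M, G.[M] != 0 -> map_poly (horner_eval M) p = 0) ->
  p = 0.
Proof.
move=> [G G0 HG]; apply/polyP => j; rewrite coef0; apply/eqP.
apply: contraT => pj0; have /closed_nonrootP[M] := mulf_neq0 G0 pj0.
rewrite /root hornerM mulf_eq0 negb_or => /andP[/HG/polyP/(_ j)].
by rewrite coef_map coef0 /= horner_evalE => ->; rewrite eqxx.
Qed.

Lemma polyY_divides p : map_poly (horner_eval 0) p = 0 -> exists q, p = 'Y * q.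
Proof.
move=> p0; have /factor_theorem[q pq] : root (swapXY p) 0.
  by rewrite /root -[0]/(0%:P) horner_swapXY p0.
exists (swapXY q); apply: (can_inj (@swapXYK _)).
by rewrite pq subr0 rmorphM /= swapXYK swapXY_Y mulrC.
Qed.

Lemma A_poly_polyY_free : map_poly (horner_eval 0) A != 0.
Proof.
apply: contraNneq (A_value_2_0 n (_ : 2 != 0 :> C)) => [A0|]; last by rewrite pnatr_eq0.
by rewrite -horner_A_poly -horner_map_eval A0 horner0.
Qed.

(** Factors M are removed one at a time: setting M = 0 kills the left side but not A, so the
    cofactor of A is divisible by M. *)
Lemma A_poly_cancel_polyY p q e : 'Y ^+ e * p = q * A -> exists r, p = r * A.
Proof.
elim: e p q => [|e IH] p q; first by rewrite expr0 mul1r => ->; exists q.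
rewrite exprSr -mulrA => /IH [r rE].
have /polyY_divides[r' r'E] : map_poly (horner_eval 0) r = 0.
  have := A_poly_polyY_free; move: rE; move: (A) => B rE B0.
  have := congr1 (map_poly (horner_eval 0)) rE; rewrite !rmorphM /= map_polyC /=.
  rewrite horner_evalE hornerX mul0r => /esym/eqP.
  by rewrite mulf_eq0 (negPf B0) orbF => /eqP.
exists r'; apply: (mulfI (_ : 'Y != 0)); first by rewrite polyC_eq0 polyX_eq0.
by rewrite rE r'E -[LHS]mulrA.
Qed.

Lemma polyZ_A_size_lead : size A = (riley_deg n).+1 /\
  lead_coef A = (twist_sign n)%:~R * 'X^(A_lead_deg n).
Proof.
have [As Al] := polyZ_A_top.
have X0 : (twist_sign n)%:~R * 'X^(A_lead_deg n) != 0 :> {poly C}.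
  by have := polyZ_A_lead_neq0 (oner_neq0 C); apply: contraNneq => ->; rewrite horner0.
have sA : size A = (riley_deg n).+1.
  by apply/eqP; rewrite eqn_leq As ltnNge; apply: contraNN X0 => le; rewrite -Al nth_default.
by rewrite lead_coefE sA.
Qed.

(** At generic M the remainder of pseudo-division in L has [riley_deg n] roots but smaller degree,
    so it is zero. The power of +-M^e introduced by the pseudo-division is then cancelled. *)
Lemma A_poly_divides p :
  (forall L M, eigenvalue_pair n L M -> p.[L, M] = 0) -> exists q, p = q * A.
Proof.
move=> p0; have [sA lA] := polyZ_A_size_lead.
have A0 : A != 0 by rewrite -size_poly_eq0 sA.
have r0 : p %% A = 0.
  apply: poly_eq0_generic; have [G G0 HG] := eigenvalue_pair_generic C n.
  exists G => // M /HG [Ls [Lu Ls_size Lp]].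
  apply: contraTeq (ltn_modpN0 p A0) => r0; rewrite -leqNgt sA -Ls_size.
  apply: leq_trans (max_poly_roots r0 _ Lu) (size_poly _ _).
  apply/allP => L /Lp LM; rewrite /root horner_map_eval.
  have := congr1 (fun q => q.[L, M]) (Pdiv.Idomain.divp_eq p A).
  rewrite /= hornerZ hornerM hornerD hornerM p0 // mulr0 hornerD hornerM.
  by rewrite horner_A_poly (eigenvalue_pair_A_value LM) mulr0 add0r => <-.
have := Pdiv.Idomain.divp_eq p A; rewrite r0 addr0 lA.
set k := (X in _ ^+ X *: _); set q := p %/ A; rewrite exprMn -mul_polyC => E.
(* The sign is its own inverse, so its power moves to the quotient. *)
apply: (@A_poly_cancel_polyY p ((twist_sign n)%:~R ^+ k * q) (A_lead_deg n * k)).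
rewrite -[RHS]mulrA -E polyCM !polyC_exp rmorph_int -exprM !mulrA -exprMn.
by rewrite twist_sign_sqr expr1n mul1r.
Qed.

Lemma A_poly_zeros L M :
  A.[L, M] = 0 <-> zariski_closure (eigenvalue_pair (K := C) n) L M.
Proof.
split=> [A0 p /A_poly_divides[q ->] | ]; first by rewrite 2!hornerM A0 mulr0.
by apply=> x y /eigenvalue_pair_A_value; rewrite horner_A_poly.
Qed.

(* At a generic M the roots in L are distinct and each one is already a root of
   q * r, so q does not involve L. *)
Lemma A_poly_square_factor_size q r : A = q ^+ 2 * r -> (size q <= 1)%N.
Proof.
move=> fA; have [sA lA] := polyZ_A_size_lead.
have [G G0 HG] := eigenvalue_pair_generic C n.
have /closed_nonrootP[M] : 'X * G != 0 by rewrite mulf_neq0 ?polyX_eq0.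
rewrite /root hornerM hornerX mulf_eq0 negb_or => /andP[M0 /HG[Ls [Lu Ls_size Lp]]].
(* This coefficient divides +-M^e, so evaluation at M preserves the degree of [q * r] in L. *)
have lqr : (lead_coef (q * r)).[M] != 0.
  have : (lead_coef A).[M] != 0 by rewrite lA polyZ_A_lead_neq0.
  by rewrite fA expr2 -mulrA lead_coefM hornerM mulf_eq0 negb_or => /andP[].
have sqr : size (map_poly (horner_eval M) (q * r)) = size (q * r).
  by rewrite size_map_poly_id0.
have qr0 : q * r != 0 by apply: contraNneq lqr => ->; rewrite lead_coef0 horner0.
have : (size Ls < size (map_poly (horner_eval M) (q * r)))%N.
  apply: max_poly_roots Lu; first by rewrite -size_poly_eq0 sqr size_poly_eq0.
  apply/allP => L /Lp/eigenvalue_pair_A_value; rewrite -horner_A_poly fA.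
  rewrite /root horner_map_eval expr2 -mulrA hornerM hornerM => /eqP.
  by rewrite mulf_eq0 => /orP[/eqP q0 | //]; rewrite hornerM hornerM q0 mul0r.
have [q0 r0] : q != 0 /\ r != 0 by move: qr0; rewrite mulf_eq0 negb_or => /andP[].
rewrite sqr Ls_size -ltnS -sA fA expr2 -mulrA size_mul //.
have : (0 < size (q * r)%R)%N by rewrite size_poly_gt0.
by move: (size (q * r)%R) (size q) => u v; lia.
Qed.

End Main.

(** A coefficient that is a unit of Z gives coprimality of all coefficients and makes constant
    square factors units. *)
Lemma A_poly_top_coef n : (A_poly n)`_(riley_deg n)`_(A_lead_deg n) = twist_sign n.
Proof.
by have [_ ->] := A_poly_top n; rewrite mulrzl coefMrz coefXn eqxx intz.
Qed.

(** A square factor is free of L, say a(M), and a^2 divides the leading coefficient +-M^e, so 0 is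
    its only possible root. That root is excluded since the formula does not vanish identically at M
    = 0, so a is an integer whose square divides +-1. *)
Lemma A_poly_no_repeated_factor (C : numClosedFieldType) n :
  no_repeated_factor (A_poly n).
Proof.
move=> q r Aqr.
have iinj : injective (map_poly (intr : int -> C)).
  by apply: map_inj_poly; [exact: intr_inj | rewrite mulr0z].
have fA : A_value n 'X 'Y = polyZ_to C q ^+ 2 * polyZ_to C r.
  by rewrite -(polyZ_to_A_poly C) Aqr /polyZ_to rmorphM rmorphXn.
have := A_poly_square_factor_size fA.
rewrite /polyZ_to size_map_inj_poly ?map_poly0 // => /size1_polyC qE.
move: (q`_0) qE => a qE; rewrite {q}qE in Aqr fA *.
have [_] := A_poly_top n; rewrite Aqr -polyC_exp coefCM => aE.
have sa : (size a <= 1)%N.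
  rewrite leqNgt; apply/negP => a1.
  have /closed_rootP[x] : size (map_poly (intr : int -> C) a) != 1.
    by rewrite size_map_inj_poly ?mulr0z ?neq_ltn ?a1 ?orbT //; exact: intr_inj.
  move=> /rootP ax; have x0 : x = 0.
    apply/eqP; apply: contraT => /(polyZ_A_lead_neq0 n).
    have := congr1 (fun p => (map_poly (intr : int -> C) p).[x]) aE.
    rewrite /= expr2 -mulrA [in LHS]rmorphM hornerM ax mul0r.
    by rewrite rmorphM rmorph_int /= map_polyXn => <-; rewrite eqxx.
  have ch2 : 2 != 0 :> C by rewrite pnatr_eq0.
  have := A_value_2_0 n ch2; rewrite -horner_A_poly fA /polyZ_to map_polyC /=.
  rewrite expr2 -mulrA hornerM hornerC hornerM.
  by rewrite x0 in ax; rewrite ax mul0r eqxx.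
rewrite (size1_polyC sa) in Aqr *; do 2!apply: rmorph_unit.
have := A_poly_top_coef n; rewrite Aqr -!polyC_exp !coefCM => cE.
have : twist_sign n \is a GRing.unit by case: (n).
by rewrite -cE expr2 !unitrM -andbA => /andP[].
Qed.

Lemma A_poly_coprime_coefs n : coprime_coefs (A_poly n).
Proof.
move=> d /(_ (riley_deg n) (A_lead_deg n)); rewrite A_poly_top_coef dvdzE.
have -> : absz (twist_sign n) = 1%N by case: n.
by rewrite dvdn1 -abszE => /eqP ->.
Qed.

Theorem theorem1p3 (R : realType) (n : int) :
  exists A : {poly {poly int}},
    is_A_polynomial (complex R) n A /\ tofrac A = twist_formula n.
Proof.
exists (A_poly n); split; last exact: tofrac_A_poly_formula.
split; [exact: A_poly_coprime_coefs | exact: (@A_poly_no_repeated_factor (complex R)) |].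
by move=> L M; rewrite (polyZ_to_A_poly (complex R)); apply: A_poly_zeros.
Qed.
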